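(* Let $A\in\mathbb{R}^{m\times n}$, $b\in\mathbb{R}^m$ and $c\in\mathbb{R}^n$. The set of all $p\in\mathbb{R}^n$ such that the perturbed linear program $$\min_{x\in\mathbb{R}^n}\ (c+p)^\top x\quad\text{s.t. } Ax=b,\ x\ge 0$$ has multiple optimal solutions (i.e. at least two distinct optimal solutions) is of zero Lebesgue measure in $\mathbb{R}^n$.
   Context: The inequality $x\ge 0$ is componentwise. An optimal solution is a feasible point attaining the minimum of the objective over the feasible set. *)

(* Defs.v *)
From HB Require Import structures.
From mathcomp Require Import all_boot all_order all_algebra.
From mathcomp Require Import all_classical all_reals all_analysis.

Set Implicit Arguments.
Unset Strict Implicit.
Unset Printing Implicit Defensive.

Import Order.TTheory GRing.Theory Num.Theory.
Import numFieldNormedType.Exports.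

Local Open Scope classical_set_scope.
Local Open Scope ring_scope.

Section LinearProgram.
Context {R : realType} {m n : nat}.
Implicit Types (A : 'M[R]_(m, n)) (b : 'cV[R]_m) (c x : 'cV[R]_n).

Definition feasible A b : set 'cV[R]_n :=
  [set x | A *m x = b /\ forall i, 0 <= x i ord0].

Definition objective c x : R := (c^T *m x) ord0 ord0.

Definition optimal_solutions A b c : set 'cV[R]_n :=
  [set x | feasible A b x /\
           forall y, feasible A b y -> objective c x <= objective c y].

Definition multiple_optimal_solutions A b c : Prop :=
  exists x y, [/\ optimal_solutions A b c x,
                  optimal_solutions A b c y & x <> y].

End LinearProgram.

(* The library has Lebesgue measure on R and binary product measures; Lebesgue
   measure on R^n is built here as the n-fold product of [lebesgue_measure] on
   [n.-tuple], whose sigma-algebra is the product, i.e. Borel, one.  It is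
   characterized by [lebesgue_tuple_box].  In dimension 0 it is the unit mass at
   the only point.                                                            *)
Section ConsMeasure.
Context {R : realType} {n : nat}.
Local Notation T := (measurableTypeR R).

Definition tuple_cons (z : T * n.-tuple T) : n.+1.-tuple T :=
  [the n.+1.-tuple T of z.1 :: z.2].

Lemma measurable_tuple_cons : measurable_fun setT tuple_cons.
Proof. exact: measurable_cons. Qed.

Definition cons_measure (mu : set (n.-tuple T) -> \bar R) :
    set (n.+1.-tuple T) -> \bar R :=
  pushforward (lebesgue_measure \x mu)%E tuple_cons.

Variable mu : {sigma_finite_measure set (n.-tuple T) -> \bar R}.

Let mtc A : measurable A -> measurable (tuple_cons @^-1` A).
Proof.
by move=> mA; rewrite -[X in measurable X]setTI; exact: measurable_tuple_cons.
Qed.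

Let cons_measure0 : cons_measure mu set0 = 0%E.
Proof. by rewrite /cons_measure /pushforward preimage_set0 measure0. Qed.

Let cons_measure_ge0 A : (0 <= cons_measure mu A)%E.
Proof.
exact: (measure_ge0 [the {measure set (T * n.-tuple T)%type -> \bar R}
                       of (lebesgue_measure \x mu)%E]).
Qed.

Let cons_measure_sigma_additive : semi_sigma_additive (cons_measure mu).
Proof.
move=> F mF tF mUF; rewrite /cons_measure /pushforward preimage_bigcup.
apply: measure_semi_sigma_additive.
- by move=> k; exact: mtc.
- apply/trivIsetP => /= i j _ _ ij; rewrite -preimage_setI.
  by move/trivIsetP : tF => /(_ _ _ _ _ ij) ->//; rewrite preimage_set0.
- by rewrite -preimage_bigcup; exact: mtc.
Qed.

HB.instance Definition _ := isMeasure.Build _ _ _ (cons_measure mu)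
  cons_measure0 cons_measure_ge0 cons_measure_sigma_additive.

Let cons_measure_sigma_finite : sigma_finite setT (cons_measure mu).
Proof.
pose g (t : n.+1.-tuple T) : (T * n.-tuple T)%type :=
  (tnth t ord0, [tuple of behead t]).
have mg : measurable_fun setT g.
  apply: measurable_fun_pair; last exact: measurable_behead.
  exact: measurable_tnth.
have fK : cancel tuple_cons g.
  by move=> [x t]; rewrite /g; congr pair; exact: val_inj.
have /sigma_finiteP[F [TF ndF Foo]] := sigma_finiteT (@lebesgue_measure R).
have /sigma_finiteP[G [TG ndG Goo]] := sigma_finiteT mu.
exists (fun k => g @^-1` (F k `*` G k)).
  apply/esym/seteqP; split => // t _.
  have [k _ Fk] : (\bigcup_k F k) (g t).1 by rewrite -TF.
  have [l _ Gl] : (\bigcup_l G l) (g t).2 by rewrite -TG.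
  exists (maxn k l) => //; split.
  - by move: Fk; apply/subsetPset/ndF/leq_maxl.
  - by move: Gl; apply/subsetPset/ndG/leq_maxr.
move=> k; have [mF Fy] := Foo k; have [mG Gy] := Goo k; split.
  by rewrite -[X in measurable X]setTI; apply: mg => //; exact: measurableX.
rewrite /cons_measure /pushforward (_ : _ @^-1` (g @^-1` _) = F k `*` G k).
  by rewrite product_measure1E// lte_mul_pinfty// ge0_fin_numE.
by rewrite -comp_preimage (_ : g \o tuple_cons = id)//; exact/funext.
Qed.

HB.instance Definition _ := Measure_isSigmaFinite.Build _ _ _ (cons_measure mu)
  cons_measure_sigma_finite.

End ConsMeasure.

Section LebesgueTuple.
Context {R : realType}.
Local Notation T := (measurableTypeR R).

Fixpoint lebesgue_tuple n : {sigma_finite_measure set (n.-tuple T) -> \bar R} :=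
  match n with
  | 0%N => dirac [the 0.-tuple T of [::]]
  | n'.+1 => cons_measure (lebesgue_tuple n')
  end.

Lemma lebesgue_tuple_box n (A : 'I_n -> set T) :
  (forall i, measurable (A i)) ->
  lebesgue_tuple n [set t | forall i, A i (tnth t i)] =
  (\prod_(i < n) lebesgue_measure (A i))%E.
Proof.
elim: n A => [|n IH] A mA.
  by rewrite big_ord0 /= diracE mem_set// => -[].
rewrite big_ord_recl -IH//= /cons_measure /pushforward -product_measure1E//.
- congr product_measure1; apply/seteqP; split => -[x t] /=.
    move=> At; split => [|i]; first exact: (At ord0).
    by have := At (lift ord0 i); rewrite tnthS.
  move=> [Ax At] i; have [j ->|->//] := unliftP ord0 i.
  by rewrite tnthS.
- rewrite (_ : [set _ | _] =
      \bigcap_(i in [set: 'I_n]) (@tnth n T ^~ i @^-1` A (lift ord0 i))).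
    apply: fin_bigcap_measurable => // i _.
    by rewrite -[X in measurable X]setTI; exact: measurable_tnth.
  by apply/seteqP; split => t /= At i; [move=> _|]; exact: At.
Qed.

(* [.-negligible] asks for inclusion in a Borel set of measure zero, which is
   having measure zero for the completed, i.e. Lebesgue, measure.             *)
Definition lebesgue_null n (S : set 'cV[R]_n) : Prop :=
  (lebesgue_tuple n).-negligible
    [set t : n.-tuple T | S (\col_i tnth t i)].

End LebesgueTuple.

(* Main.v *)
Require Import Defs.
From mathcomp Require Import all_boot all_order all_algebra.
From mathcomp Require Import all_classical all_reals all_analysis.
From mathcomp Require Import measurable_realfun ring lra.

(** If x and y are two distinct optimal points for the cost c + p, then so is
    their midpoint z, and x - y is a nonzero kernel vector of A whose support
    lies in the support J of z.  Moving z slightly along any kernel vector e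
    supported in J, in either direction, keeps it feasible, so optimality of z
    forces e to be orthogonal to c + p ([optimal_orthogonal]).  This applies
    to every such e, hence to one that was chosen beforehand as a function of
    J alone.  There are finitely many supports J, so the bad perturbations p
    lie in a finite union of affine hyperplanes, each of which is null
    ([lebesgue_tuple_hyperplane], by Fubini). *)

Import Order.TTheory GRing.Theory Num.Theory.

Local Open Scope classical_set_scope.
Local Open Scope ring_scope.

Section Objective.
Context {R : realType} {n : nat}.
Implicit Types (c x y : 'cV[R]_n) (a : R).

Lemma objectiveE c x : objective c x = \sum_i x i ord0 * c i ord0.
Proof. by rewrite /objective mxE; apply: eq_bigr => i _; rewrite mxE mulrC. Qed.

Lemma objectiveD c x y : objective c (x + y) = objective c x + objective c y.
Proof. by rewrite /objective mulmxDr mxE. Qed.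

Lemma objectiveZ c a x : objective c (a *: x) = a * objective c x.
Proof. by rewrite /objective -scalemxAr mxE. Qed.

End Objective.

Section OptimalFace.
Context {R : realType} {m n : nat}.
Variables (A : 'M[R]_(m, n)) (b : 'cV[R]_m) (c : 'cV[R]_n).

Lemma optimal_midpoint x y :
  optimal_solutions A b c x -> optimal_solutions A b c y ->
  optimal_solutions A b c (2^-1 *: (x + y)).
Proof.
move=> [[Ax x0] xmin] [[Ay y0] ymin]; split; first split.
- by rewrite -scalemxAr mulmxDr Ax Ay; apply/matrixP => i j; rewrite !mxE; lra.
- by move=> i; rewrite !mxE mulr_ge0// addr_ge0.
- move=> z Fz; rewrite objectiveZ objectiveD.
  by have := xmin _ Fz; have := ymin _ Fz; lra.
Qed.

(** A nonnegative vector dominates a small multiple of any vector supported in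
    its support. *)
Lemma small_multiple_le (z e : 'cV[R]_n) :
  (forall i, 0 <= z i ord0) -> (forall i, z i ord0 = 0 -> e i ord0 = 0) ->
  exists2 eps : R, 0 < eps & forall i, eps * `|e i ord0| <= z i ord0.
Proof.
(* Where z vanishes so does e, and the summand is 0 / 0 = 0. *)
move=> z0 ze; pose s := \sum_i `|e i ord0| / z i ord0.
have q0 i : 0 <= `|e i ord0| / z i ord0 by rewrite divr_ge0.
have s0 : 0 < 1 + s by rewrite ltr_pwDl// sumr_ge0.
exists (1 + s)^-1 => [|i]; first by rewrite invr_gt0.
have [/eqP zi0|zi0] := boolP (z i ord0 == 0).
  by rewrite zi0 (ze _ zi0) normr0 mulr0.
rewrite ler_pdivrMl// -ler_pdivrMr ?lt_neqAle ?z0 1?eq_sym ?zi0//.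
rewrite /s (bigD1 i)//=.
have : 0 <= \sum_(j < n | j != i) `|e j ord0| / z j ord0 by rewrite sumr_ge0.
lra.
Qed.

(** An optimal point z is in the relative interior of the face of feasible
    points supported in the support of z, hence the objective is constant on
    that face. *)
Lemma optimal_orthogonal (z e : 'cV[R]_n) :
  optimal_solutions A b c z -> A *m e = 0 ->
  (forall i, z i ord0 = 0 -> e i ord0 = 0) -> objective c e = 0.
Proof.
move=> [[Az z0] zmin] Ae ze.
have [eps eps0 epsle] := small_multiple_le z e z0 ze.
have F (a : R) : `|a| = eps -> feasible A b (z + a *: e).
  move=> ae; split; first by rewrite mulmxDr -scalemxAr Ae scaler0 addr0.
  move=> i; rewrite !mxE; have := epsle i.
  by rewrite -ae -normrM ler_norml => /andP[+ _]; lra.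
have := zmin _ (F eps (gtr0_norm eps0)).
have := zmin _ (F (- eps) (etrans (normrN _) (gtr0_norm eps0))).
rewrite !objectiveD !objectiveZ => h1 h2.
by apply: (mulfI (lt0r_neq0 eps0)); lra.
Qed.

End OptimalFace.

Section Hyperplane.
Context {R : realType}.
Local Notation T := (measurableTypeR R).

(** The affine hyperplane of normal vector e and level a, as a set of tuples;
    it is a genuine hyperplane only when e is nonzero. *)
Definition hyperplane {n} (e : 'I_n -> R) (a : R) : set (n.-tuple T) :=
  [set t | \sum_i e i * tnth t i = a].

Lemma measurable_hyperplane n (e : 'I_n -> R) a : measurable (hyperplane e a).
Proof.
rewrite /hyperplane.
have mf : measurable_fun setT (fun t : n.-tuple T => \sum_i e i * tnth t i).
  apply: measurable_sum => i; apply: measurable_funM => //.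
  exact: measurable_tnth.
rewrite -[X in measurable X]setTI.
exact: (mf measurableT _ (measurable_set1 a)).
Qed.

(** Induction on the dimension, slicing off the first coordinate.  If the
    first coefficient vanishes, every slice at a fixed first coordinate is a
    hyperplane of lower dimension; otherwise every line parallel to the first
    axis meets the hyperplane in a single point. *)
Lemma lebesgue_tuple_hyperplane n (e : 'I_n -> R) a i :
  e i != 0 -> lebesgue_tuple n (hyperplane e a) = 0%E.
Proof.
elim: n e a i => [|n IH] e a i; first by case: i.
move=> ei.
have mH : measurable (tuple_cons @^-1` hyperplane e a : set (T * n.-tuple T)).
  rewrite -[X in measurable X]setTI; apply: measurable_tuple_cons => //.
  exact: measurable_hyperplane.
have HE (x : T) (t : n.-tuple T) : (hyperplane e a) (tuple_cons (x, t)) <->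
    e ord0 * x + \sum_i e (lift ord0 i) * tnth t i = a.
  rewrite /hyperplane /= big_ord_recl.
  rewrite (eq_bigr (fun i => e (lift ord0 i) * tnth t i))// => j _.
  by congr (_ * _); exact: tnthS.
rewrite /= /cons_measure /pushforward.
have [e0|e0] := eqVneq (e ord0) 0.
- have [j ij|ij] := unliftP ord0 i; last by move: ei; rewrite ij e0 eqxx.
  apply: integral0_eq => x _ /=.
  rewrite (_ : xsection _ _ = hyperplane (fun i => e (lift ord0 i)) a).
    by apply: (IH _ _ j); rewrite -ij.
  apply/seteqP; split => t; rewrite /xsection /= inE => h.
    by have /HE := h; rewrite e0 mul0r add0r.
  by apply/HE; rewrite e0 mul0r add0r.
- (* Exchange the order of integration, to integrate over lines first. *)
  rewrite (@product_measure_unique _ _ _ _ _ _ _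
    (lebesgue_measure \x^ lebesgue_tuple n)%E)//; last first.
    by move=> *; exact: product_measure2E.
  apply: integral0_eq => t _ /=.
  rewrite (_ : ysection _ _ =
      [set (a - \sum_i e (lift ord0 i) * tnth t i) / e ord0]).
    exact: lebesgue_measure_set1.
  apply/seteqP; split => x; rewrite /ysection /= inE => h.
    by have /HE <- := h; rewrite addrK mulrC mulKf.
  by apply/HE; rewrite h mulrC divfK// subrK.
Qed.

End Hyperplane.

Theorem lemma1 (R : realType) (m n : nat)
    (A : 'M[R]_(m, n)) (b : 'cV[R]_m) (c : 'cV[R]_n) :
  lebesgue_null [set p : 'cV[R]_n | multiple_optimal_solutions A b (c + p)].
Proof.
pose K (J : {set 'I_n}) : set 'cV[R]_n :=
  [set e | [/\ e != 0, A *m e = 0 & forall i, i \notin J -> e i ord0 = 0]].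
(* The default 0 records that no nonzero kernel vector is supported in J. *)
pose E J := xget 0 (K J).
pose H J : set (n.-tuple (measurableTypeR R)) :=
  [set t | E J != 0 /\ objective (c + \col_i tnth t i) (E J) = 0].
have H0 J : (lebesgue_tuple n).-negligible (H J).
  have [ES0|ES0] := eqVneq (E J) 0.
    by rewrite /H ES0 eqxx (_ : [set _ | _] = set0)//;
      [exact: negligible_set0|apply/seteqP; split => t []].
  have [i ei] : exists i, E J i ord0 != 0.
    by have /cV0Pn := ES0.
  exists (hyperplane (fun i => E J i ord0) (- objective c (E J))); split.
  - exact: measurable_hyperplane.
  - exact: (lebesgue_tuple_hyperplane n (fun i => E J i ord0) _ i ei).
  - move=> t [_]; rewrite /hyperplane/= !objectiveE => h.
    apply/eqP; rewrite -addr_eq0 -big_split /=; apply/eqP; rewrite -[RHS]h.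
    by apply: eq_bigr => j _; rewrite !mxE mulrDr addrC.
(* The union over all supports, reindexed by the natural numbers. *)
pose F k := if unpickle k is Some J then H J else set0.
apply: (negligibleS (A := \bigcup_k F k)); last first.
  apply: negligible_bigcup => k; rewrite /F.
  by case: unpickle => [J|]; [exact: H0|exact: negligible_set0].
move=> t /= [x [y [ox oy xy]]].
have oz := optimal_midpoint _ _ _ _ _ ox oy.
set z := _ *: _ in oz.
pose J := [set i | z i ord0 != 0]%SET.
have KE : K J (E J).
  apply: (@xgetI _ _ _ (x - y)).
  have [[Ax x0] _] := ox; have [[Ay y0] _] := oy; split.
  - by rewrite subr_eq0; apply/eqP.
  - by rewrite mulmxBr Ax Ay subrr.
  - move=> i; rewrite inE negbK !mxE => /eqP.
    by have := x0 i; have := y0 i; lra.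
exists (pickle J) => //; rewrite /F pickleK.
have [E0 AE sE] := KE; split=> //.
apply: optimal_orthogonal oz AE _ => i zi.
by apply: sE; rewrite inE zi eqxx.
Qed.
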